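(* Let $a,b$ be positive integers, $B>1$ an integer, and $z\in\mathbb{C}$ with $|z|\le1$. Define $(a_k)_{k\ge0}$ by $$\frac{1}{1-x}\sum_{k=0}^{\infty}\frac{x^{bB^k}(1-x^{B^k})}{1-zx^{aB^k}}=\sum_{k=0}^{\infty}a_kx^k .$$ Then $$\gamma_{a,b}(z)=\int_0^1\frac{x^{b-1}(1-x)}{1-zx^a}\,dx-\sum_{k=1}^{\infty}a_k\widetilde{Q}(k,B),$$ where $\widetilde{Q}(k,B)=\sum_{m=1}^{B-1}\frac{B-m}{(Bk+B)(Bk+m)}$ $\bigl(=\frac{B-1}{Bk(k+1)}-Q(k,B)$ with $Q(k,B)=\sum_{m=1}^{B-1}\frac{m}{Bk(Bk+m)}\bigr)$.
   Context: $\gamma_{a,b}(z)=\sum_{n=0}^{\infty}\left(\frac{1}{an+b}-\log\frac{an+b+1}{an+b}\right)z^n$ for $|z|\le1$. *)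

(* Defs.v *)
From Stdlib Require Import Reals.
From Coquelicot Require Import Coquelicot.

Open Scope C_scope.

(* Coquelicot's [Series] is real-valued; complex series are summed componentwise. *)
Definition CSeries (u : nat -> C) : C :=
  (Series (fun n => Re (u n)), Series (fun n => Im (u n))).

Definition gamma_term (a b : nat) (z : C) (n : nat) : C :=
  RtoC (1 / INR (a * n + b)
        - ln (INR (a * n + b + 1) / INR (a * n + b)))%R * z ^ n.

Definition gamma (a b : nat) (z : C) : C := CSeries (gamma_term a b z).

Definition gen_term (a b B : nat) (z x : C) (k : nat) : C :=
  x ^ (b * B ^ k) * (1 - x ^ (B ^ k)) / (1 - z * x ^ (a * B ^ k)).

(* The coefficients are tied to the generating function by an identity of
   convergent series on the open unit disk, which determines them uniquely;
   [s] is the sum of the inner series. *)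
Definition is_gen_coeffs (a b B : nat) (z : C) (c : nat -> C) : Prop :=
  forall x : C, (Cmod x < 1)%R ->
    exists s : C,
      is_series (gen_term a b B z x) s /\
      is_series (fun k => c k * x ^ k) (1 / (1 - x) * s).

(* For z = 1 the quotient is 0/0 at the endpoint x = 1; the value there does
   not affect the Riemann integral over [0, 1]. *)
Definition integrand (a b : nat) (z : C) (x : R) : C :=
  RtoC x ^ (b - 1) * (1 - RtoC x) / (1 - z * RtoC x ^ a).

Definition Q (k B : nat) : R :=
  sum_n_m (fun m => INR m / (INR B * INR k * (INR B * INR k + INR m)))%R
    1 (B - 1).

Definition Qtilde (k B : nat) : R :=
  sum_n_m (fun m => INR (B - m)
      / ((INR B * INR k + INR B) * (INR B * INR k + INR m)))%R
    1 (B - 1).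

(* Main.v *)
Require Import Defs.
From Stdlib Require Import Reals Lia Lra Arith.
From Coquelicot Require Import Coquelicot.

(* Let w(a n + b) = z^n and w = 0 off this progression. The functional equation
   S(x) = x^b (1 - x) / (1 - z x^a) + S(x^B) of the inner series says that
   c_k = w_k + c_(k/B), k/B being the integer quotient; hence c_0 = 0 and
   c_k = O(sqrt k). With g(j) = log((j+1)/j) - 1/(j+1) one has
   Qtilde(k) = g(k) - sum_(m < B) g(B k + m), so that
     sum_(k <= N) c_k Qtilde(k)
       = sum_(j <= N) w_j g(j) - sum_(N < j < B (N+1)) c_(j/B) g(j),
   where the last sum tends to 0 since 0 <= g(j) <= 1/j - 1/(j+1). Thus the sum
   over k of c_k Qtilde(k) is the sum over n of z^n g(a n + b), while expanding
   1/(1 - z x^a) turns the integral into the sum over n of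
   z^n (1/(a n + b) - 1/(a n + b + 1)). *)

Open Scope C_scope.

(** * Convergence of complex series *)

(** Balls of [C] are products of balls in the two coordinates, so neighbourhoods can be tested
    coordinate by coordinate. This links [is_series] in [C] to [CSeries]. *)
Lemma is_series_C (u : nat -> C) (l : C) :
  is_series u l <->
  is_series (fun n => Re (u n)) (Re l) /\ is_series (fun n => Im (u n)) (Im l).
Proof.
  assert (Hs : forall N, sum_n u N
    = (sum_n (fun n => Re (u n)) N, sum_n (fun n => Im (u n)) N)).
  { induction N as [|N IH].
    - rewrite !sum_O. now destruct (u O).
    - rewrite !sum_Sn, IH. reflexivity. }
  unfold is_series. split.
  - intros H. split.
    + intros P [eps HP].
      destruct (H (fun y => P (fst y))) as [N HN].
      { exists eps. intros y Hy. apply HP, Hy. }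
      exists N. intros n Hn. generalize (HN n Hn). now rewrite Hs.
    + intros P [eps HP].
      destruct (H (fun y => P (snd y))) as [N HN].
      { exists eps. intros y Hy. apply HP, Hy. }
      exists N. intros n Hn. generalize (HN n Hn). now rewrite Hs.
  - intros [H1 H2] P [eps HP].
    destruct (H1 (ball (Re l) eps)) as [N1 HN1]; [now exists eps|].
    destruct (H2 (ball (Im l) eps)) as [N2 HN2]; [now exists eps|].
    exists (max N1 N2). intros n Hn. apply HP. rewrite Hs. split; simpl.
    + apply HN1; lia.
    + apply HN2; lia.
Qed.

Lemma CSeries_unique (u : nat -> C) (l : C) : is_series u l -> CSeries u = l.
Proof.
  intros [H1 H2]%is_series_C. unfold CSeries.
  rewrite (is_series_unique _ _ H1), (is_series_unique _ _ H2).
  now destruct l.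
Qed.

(** [filterlim_locally_ball_norm] trades the coordinatewise balls for those of [Cmod], in which all
    error estimates below are made. *)
Lemma is_series_C_bound (u : nat -> C) (l : C) (e : nat -> R) :
  (forall n, (Cmod (sum_n u n - l) <= e n)%R) -> is_lim_seq e 0 -> is_series u l.
Proof.
  intros Hb He. unfold is_series.
  apply (filterlim_locally_ball_norm (U := C_NormedModule)). intros eps.
  apply is_lim_seq_spec in He. destruct (He eps) as [N HN].
  exists N. intros n Hn. specialize (HN n Hn). specialize (Hb n).
  unfold ball_norm. change (Cmod (sum_n u n - l) < eps)%R.
  rewrite Rminus_0_r in HN. apply Rabs_def2 in HN. lra.
Qed.

(** This and the next two lemmas fix the module structure on [C] and speak of its own operations, so
    that [ring] and rewriting act on the results. *)
Lemma is_series_Cext (u v : nat -> C) (l : C) :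
  (forall n, u n = v n) -> is_series u l -> is_series v l.
Proof. exact (is_series_ext (V := C_NormedModule) u v l). Qed.

Lemma is_series_Cmult (q : C) (u : nat -> C) (l : C) :
  is_series u l -> is_series (fun n => q * u n) (q * l).
Proof. exact (is_series_scal (V := C_NormedModule) q u l). Qed.

Lemma is_series_Cminus (u v : nat -> C) (lu lv : C) :
  is_series u lu -> is_series v lv ->
  is_series (fun n => u n - v n) (lu - lv).
Proof. exact (is_series_minus (V := C_NormedModule) u v lu lv). Qed.

Lemma is_series_C_unique (u : nat -> C) (l1 l2 : C) :
  is_series u l1 -> is_series u l2 -> l1 = l2.
Proof.
  intros H1 H2. now rewrite <- (CSeries_unique _ _ H1), (CSeries_unique _ _ H2).
Qed.

Lemma is_series_C_tail (u : nat -> C) (l : C) :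
  is_series u (u 0%nat + l) <-> is_series (fun n => u (S n)) l.
Proof.
  split; intros H.
  - apply is_series_incr_1.
    rewrite Cplus_comm in H. exact H.
  - apply is_series_decr_1.
    change (is_series (fun n => u (S n)) (u 0%nat + l - u 0%nat)).
    now replace (u 0%nat + l - u 0%nat) with l by ring.
Qed.

Lemma is_series_C_geom (q : C) :
  (Cmod q < 1)%R -> is_series (fun n => q ^ n) (/ (1 - q)).
Proof.
  intros Hq.
  assert (Hne : 1 - q <> 0).
  { intros E. replace q with (1 - (1 - q)) in Hq by ring. rewrite E in Hq.
    replace (1 - 0) with (RtoC 1) in Hq by ring. rewrite Cmod_1 in Hq. lra. }
  assert (Hs : forall N, sum_n (fun n => q ^ n) N = (1 - q ^ S N) / (1 - q)).
  { induction N as [|N IH].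
    - rewrite sum_O. simpl. now field.
    - rewrite sum_Sn, IH.
      change ((1 - q ^ S N) / (1 - q) + q ^ S N = (1 - q ^ S (S N)) / (1 - q)).
      simpl. now field. }
  apply is_series_C_bound with (e := fun n => (Cmod q ^ S n * / Cmod (1 - q))%R).
  - intros n. rewrite Hs.
    replace ((1 - q ^ S n) / (1 - q) - / (1 - q)) with (- (q ^ S n / (1 - q)))
      by now field.
    rewrite Cmod_opp, Cmod_div, Cmod_pow by assumption. apply Rle_refl.
  - replace (Finite 0) with (Rbar_mult 0 (/ Cmod (1 - q))%R)
      by (simpl; f_equal; apply Rmult_0_l).
    apply is_lim_seq_scal_r.
    apply (is_lim_seq_incr_1 (fun n => Cmod q ^ n)%R), is_lim_seq_geom.
    rewrite Rabs_pos_eq; [assumption|apply Cmod_ge_0].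
Qed.

(** * Uniqueness of power series coefficients *)

Lemma Re_mult_RtoC (u : C) (x : R) : Re (u * RtoC x) = (Re u * x)%R.
Proof. destruct u; simpl. ring. Qed.

Lemma Im_mult_RtoC (u : C) (x : R) : Im (u * RtoC x) = (Im u * x)%R.
Proof. destruct u; simpl. ring. Qed.

(** Convergence at 1/2 makes the terms there bounded, so the radius of convergence is positive. The
    identity theorem near 0 then applies. *)
Lemma real_power_series_zero (u : nat -> R) :
  (forall x : R, (Rabs x < 1)%R -> is_series (fun k => u k * x ^ k)%R 0%R) ->
  forall k, u k = 0%R.
Proof.
  intros H k.
  assert (Hr : Rbar_lt 0 (CV_radius u)).
  { apply Rbar_lt_le_trans with (Finite (1/2)); [simpl; lra|].
    apply CV_radius_bounded.
    assert (Hl : is_lim_seq (fun k => u k * (1/2) ^ k)%R 0).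
    { apply ex_series_lim_0. eexists. apply H. rewrite Rabs_pos_eq; lra. }
    destruct (filterlim_bounded (K := R_AbsRing) (V := R_NormedModule)
      (fun k => u k * (1/2) ^ k)%R) as [M HM].
    { exists 0%R. exact Hl. }
    exists M. exact HM. }
  apply (PSeries_ext_recip u (fun _ => 0%R)); trivial.
  - rewrite CV_radius_const_0. exact I.
  - assert (H1 : (0 < 1)%R) by lra.
    exists (mkposreal _ H1). intros x Hx.
    change (Rabs (x - 0) < 1)%R in Hx. rewrite Rminus_0_r in Hx.
    rewrite PSeries_const_0.
    apply is_pseries_unique, is_pseries_R, H, Hx.
Qed.

(** At real arguments the real and imaginary parts of the coefficients decouple into two real power
    series. *)
Lemma power_series_zero (u : nat -> C) :
  (forall x : R, (Rabs x < 1)%R -> is_series (fun k => u k * RtoC x ^ k) (RtoC 0)) ->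
  forall k, u k = 0.
Proof.
  intros H k.
  assert (H' : forall x : R, (Rabs x < 1)%R ->
    is_series (fun k => Re (u k) * x ^ k)%R 0%R /\
    is_series (fun k => Im (u k) * x ^ k)%R 0%R).
  { intros x Hx. destruct (proj1 (is_series_C _ _) (H x Hx)) as [H1 H2].
    split.
    - revert H1. apply is_series_ext. intros n.
      now rewrite <- RtoC_pow, Re_mult_RtoC.
    - revert H2. apply is_series_ext. intros n.
      now rewrite <- RtoC_pow, Im_mult_RtoC. }
  rewrite (surjective_pairing (u k)). unfold RtoC. f_equal.
  - now apply (real_power_series_zero (fun k => Re (u k))); intros x Hx; apply H'.
  - now apply (real_power_series_zero (fun k => Im (u k))); intros x Hx; apply H'.
Qed.

(** * Spreading a sequence along a progression, and differencing *)

(* [progr a b u] puts [u n] at the index [a * n + b] and [0] elsewhere. *)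
Definition progr (a b : nat) (u : nat -> C) (k : nat) : C :=
  if ((b <=? k)%nat && ((k - b) mod a =? 0)%nat)%bool then u ((k - b) / a)%nat else 0.

(** The quotient [(k - b) / a] grows by one exactly when a new nonzero slot is reached. For [b = 0]
    this is how the integer quotient [k / B] enters the recurrence for the coefficients. *)
Lemma sum_progr (a b : nat) (u : nat -> C) (k : nat) :
  (0 < a)%nat ->
  sum_n (progr a b u) k
  = if (b <=? k)%nat then sum_n u ((k - b) / a) else RtoC 0.
Proof.
  intros ha. induction k as [|k IH].
  - rewrite sum_O. unfold progr. simpl (0 - b)%nat.
    rewrite Nat.Div0.mod_0_l, Nat.Div0.div_0_l, sum_O.
    now destruct b.
  - rewrite sum_Sn, IH. unfold progr. clear IH.
    destruct (Nat.leb_spec b (S k)) as [h|h];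
      destruct (Nat.leb_spec b k) as [h'|h']; cbv beta iota delta [andb]; try lia.
    + replace (S k - b)%nat with (S (k - b)) by lia.
      set (m := (k - b)%nat). set (q := (m / a)%nat).
      assert (Hm : m = (a * q + m mod a)%nat) by apply Nat.div_mod_eq.
      assert (Hr : (m mod a < a)%nat) by (apply Nat.mod_upper_bound; lia).
      destruct (Nat.eq_dec (S (m mod a)) a) as [e|e].
      * assert (HS : S m = (S q * a)%nat) by lia.
        rewrite HS, Nat.Div0.mod_mul, Nat.div_mul by lia.
        simpl. now rewrite sum_Sn.
      * replace (S m mod a)%nat with (S (m mod a))
          by (apply Nat.mod_unique with q; lia).
        replace (S m / a)%nat with q
          by (apply Nat.div_unique with (S (m mod a)); lia).
        apply Cplus_0_r.
    + replace (S k - b)%nat with 0%nat by lia.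
      rewrite Nat.Div0.mod_0_l, Nat.Div0.div_0_l, sum_O.
      apply Cplus_0_l.
    + apply Cplus_0_l.
Qed.

Lemma is_series_progr (a b : nat) (u : nat -> C) (l : C) :
  (0 < a)%nat -> is_series u l -> is_series (progr a b u) l.
Proof.
  intros ha Hu P HP. destruct (Hu P HP) as [N HN].
  exists (a * N + b)%nat. intros k Hk.
  rewrite sum_progr by assumption.
  rewrite (proj2 (Nat.leb_le b k)) by lia.
  apply HN. apply Nat.div_le_lower_bound; lia.
Qed.

Lemma progr_mult (a b : nat) (u f : nat -> C) (k : nat) :
  progr a b u k * f k = progr a b (fun n => u n * f (a * n + b)%nat) k.
Proof.
  unfold progr.
  destruct (Nat.leb_spec b k) as [h|h]; simpl; [|apply Cmult_0_l].
  destruct (Nat.eqb_spec ((k - b) mod a) 0) as [e|e]; [|apply Cmult_0_l].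
  assert (E := Nat.div_mod_eq (k - b) a).
  replace (a * ((k - b) / a) + b)%nat with k by lia.
  reflexivity.
Qed.

(* The coefficients of [(1 - x) * sum u_k x^k]. *)
Definition diff (u : nat -> C) (k : nat) : C :=
  match k with O => u O | S j => u (S j) - u j end.

Lemma sum_diff (u : nat -> C) (k : nat) : sum_n (diff u) k = u k.
Proof.
  induction k as [|k IH].
  - now rewrite sum_O.
  - rewrite sum_Sn, IH. change (u k + (u (S k) - u k) = u (S k)). ring.
Qed.

Lemma is_series_diff (u : nat -> C) (x l : C) :
  is_series (fun k => u k * x ^ k) l ->
  is_series (fun k => diff u k * x ^ k) ((1 - x) * l).
Proof.
  intros H.
  assert (H1 : is_series (fun k => u (S k) * x ^ S k) (l - u O)).
  { apply (is_series_C_tail (fun k => u k * x ^ k)). simpl.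
    now replace (u 0%nat * 1 + (l - u 0%nat)) with l by ring. }
  assert (H2 := is_series_Cminus _ _ _ _ H1 (is_series_Cmult x _ _ H)).
  replace ((1 - x) * l) with (diff u 0 * x ^ 0 + (l - u O - x * l))
    by (simpl; ring).
  apply is_series_C_tail.
  eapply is_series_Cext; [|exact H2]. intros n. simpl. ring.
Qed.

(** * Recurrence and growth of the coefficients *)

(** At x = 0 every inner term vanishes, since its exponent [b * B ^ n] is positive, and the power
    series reduces to its constant term. *)
Lemma gen_coeffs_0 (a b B : nat) (z : C) (c : nat -> C) :
  (0 < b)%nat -> (0 < B)%nat -> is_gen_coeffs a b B z c -> c O = 0.
Proof.
  intros hb hB hc. destruct (hc 0) as [s [Hs Hc]]; [rewrite Cmod_0; lra|].
  assert (Hz : forall n, (0 < n)%nat -> 0 ^ n = 0).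
  { intros [|n] hn; [lia|]. simpl. ring. }
  assert (Hs0 : is_series (fun _ : nat => RtoC 0) s).
  { eapply is_series_Cext; [|exact Hs]. intros n. unfold gen_term.
    rewrite (Hz (b * B ^ n)%nat).
    - unfold Cdiv. rewrite !Cmult_0_l. reflexivity.
    - assert (B ^ n <> 0)%nat by (apply Nat.pow_nonzero; lia). nia. }
  assert (H0 : is_series (fun _ : nat => RtoC 0) (RtoC 0)).
  { assert (H := is_series_Cmult 0 _ _ Hc). rewrite Cmult_0_l in H.
    eapply is_series_Cext; [|exact H]. intros n. apply Cmult_0_l. }
  rewrite (is_series_C_unique _ _ _ Hs0 H0), Cmult_0_r in Hc.
  assert (Hc' : is_series (fun k => c k * 0 ^ k) (c 0%nat * 0 ^ 0 + 0)).
  { apply is_series_C_tail. eapply is_series_Cext; [|exact H0].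
    intros n. rewrite Hz by lia. now rewrite Cmult_0_r. }
  rewrite (is_series_C_unique _ _ _ Hc Hc'). simpl. ring.
Qed.

(** Multiplication by 1 - x clears the outer factor and turns [c] into [diff c]; substituting x^B
    spreads [diff c] over the multiples of [B]. Comparing coefficients in the functional equation
    and summing up to [k] undoes the differencing. *)
Lemma gen_coeffs_rec (a b B : nat) (z : C) (c : nat -> C) (k : nat) :
  (0 < a)%nat -> (0 < B)%nat -> (Cmod z <= 1)%R ->
  is_gen_coeffs a b B z c ->
  c k = progr a b (fun n => z ^ n) k + c (k / B)%nat.
Proof.
  intros ha hB hz hc.
  set (w := progr a b (fun n => z ^ n)).
  assert (H : forall j, diff c j - diff w j - progr B 0 (diff c) j = 0).
  { apply power_series_zero. intros x hx. set (y := RtoC x).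
    assert (hy : (Cmod y < 1)%R) by (unfold y; now rewrite Cmod_R).
    assert (hp : forall n, (0 < n)%nat -> (Cmod (y ^ n) < 1)%R).
    { intros n hn. rewrite Cmod_pow.
      apply pow_lt_1_compat; [split; [apply Cmod_ge_0|exact hy]|exact hn]. }
    assert (hne : 1 - y <> 0).
    { intros E. replace y with (1 - (1 - y)) in hy by ring. rewrite E in hy.
      replace (1 - 0) with (RtoC 1) in hy by ring. rewrite Cmod_1 in hy. lra. }
    assert (hneB : 1 - y ^ B <> 0).
    { intros E. specialize (hp B hB). replace (y ^ B) with (1 - (1 - y ^ B)) in hp by ring.
      rewrite E in hp.
      replace (1 - 0) with (RtoC 1) in hp by ring. rewrite Cmod_1 in hp. lra. }
    destruct (hc y hy) as [s [Hs Hc]].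
    (* The generating identity at [y ^ B] supplies S(x^B); its inner series is the tail of the one
       at [y]. *)
    destruct (hc (y ^ B) (hp B hB)) as [s' [Hs' Hc']].
    assert (Es : s = gen_term a b B z y 0 + s').
    { apply (is_series_C_unique _ _ _ Hs). apply is_series_C_tail.
      eapply is_series_Cext; [|exact Hs']. intros n. unfold gen_term.
      rewrite <- !Cpow_mult_r. simpl (B ^ S n)%nat.
      replace (B * (b * B ^ n))%nat with (b * (B * B ^ n))%nat by ring.
      replace (B * (a * B ^ n))%nat with (a * (B * B ^ n))%nat by ring.
      reflexivity. }
    apply is_series_diff in Hc, Hc'.
    replace ((1 - y) * (1 / (1 - y) * s)) with s in Hc by now field.
    replace ((1 - y ^ B) * (1 / (1 - y ^ B) * s')) with s' in Hc' by now field.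
    (* The generating function of [w] is a geometric series of ratio z x^a, moved up by x^b. *)
    assert (Hw : is_series (fun k => w k * y ^ k) (y ^ b * / (1 - z * y ^ a))).
    { assert (Hg : (Cmod (z * y ^ a) < 1)%R).
      { rewrite Cmod_mult. specialize (hp a ha).
        assert (h1 := Cmod_ge_0 z). assert (h2 := Cmod_ge_0 (y ^ a)). nra. }
      apply is_series_C_geom, (is_series_Cmult (y ^ b)),
        (is_series_progr a b _ _ ha) in Hg.
      eapply is_series_Cext; [|exact Hg]. intros n. unfold w.
      rewrite (progr_mult a b (fun n => z ^ n) (fun n => y ^ n)).
      unfold progr. destruct (_ && _)%bool; trivial.
      rewrite Cpow_mult_l, Cpow_add_r, <- !Cpow_mult_r. ring. }
    apply is_series_diff in Hw.
    apply (is_series_progr B 0 _ _ hB) in Hc'.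
    assert (HH := is_series_Cminus _ _ _ _ (is_series_Cminus _ _ _ _ Hc Hw) Hc').
    replace (s - (1 - y) * (y ^ b * / (1 - z * y ^ a)) - s') with (RtoC 0) in HH.
    2:{ rewrite Es. unfold gen_term. simpl (B ^ 0)%nat.
        rewrite !Nat.mul_1_r, Cpow_1_r. unfold Cdiv. ring. }
    eapply is_series_Cext; [|exact HH]. intros n. cbv beta.
    replace (progr B 0 (fun k0 => diff c k0 * (y ^ B) ^ k0) n)
      with (progr B 0 (diff c) n * y ^ n).
    - ring.
    - rewrite (progr_mult B 0 (diff c) (fun n => y ^ n)). unfold progr.
      destruct (_ && _)%bool; trivial.
      now rewrite Nat.add_0_r, Cpow_mult_r. }
  (* Partial sums of [diff c] and [diff w] telescope, while those of the spread sequence stop at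
     [k / B]. *)
  assert (Hsum : sum_n (diff c) k
    = plus (sum_n (diff w) k) (sum_n (progr B 0 (diff c)) k)).
  { rewrite <- sum_n_plus. apply sum_n_ext. intros j.
    change (diff c j = diff w j + progr B 0 (diff c) j).
    transitivity ((diff c j - diff w j - progr B 0 (diff c) j)
      + (diff w j + progr B 0 (diff c) j)); [ring|].
    rewrite H. ring. }
  rewrite sum_progr, !sum_diff in Hsum by assumption.
  simpl in Hsum. rewrite Nat.sub_0_r in Hsum. exact Hsum.
Qed.

Lemma progr_pow_le (a b : nat) (z : C) (k : nat) :
  (Cmod z <= 1)%R -> (Cmod (progr a b (fun n => z ^ n)%C k) <= 1)%R.
Proof.
  intros hz. unfold progr. destruct (_ && _)%bool.
  - rewrite Cmod_pow, <- (pow1 ((k - b) / a)).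
    apply pow_incr. split; [apply Cmod_ge_0|exact hz].
  - rewrite Cmod_0. lra.
Qed.

(** Strong induction along [k / B], which is at most k/2. The constant 4 closes it: 1 + 4 (3/4) sqrt
    k <= 4 sqrt k for k >= 1. The true growth is at most logarithmic, but a bound o(k) is enough
    later. *)
Lemma gen_coeffs_le_sqrt (a b B : nat) (z : C) (c : nat -> C) (k : nat) :
  (0 < a)%nat -> (0 < b)%nat -> (1 < B)%nat -> (Cmod z <= 1)%R ->
  is_gen_coeffs a b B z c -> (Cmod (c k) <= 4 * sqrt (INR k))%R.
Proof.
  intros ha hb hB hz hc.
  induction k as [k IH] using lt_wf_ind.
  destruct (Nat.eq_dec k 0) as [->|hk].
  { rewrite (gen_coeffs_0 a b B z c) by (assumption || lia).
    rewrite Cmod_0. simpl. rewrite sqrt_0. lra. }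
  rewrite (gen_coeffs_rec a b B z c k) by (assumption || lia).
  eapply Rle_trans; [apply Cmod_triangle|].
  specialize (IH (k / B)%nat (Nat.div_lt k B ltac:(lia) hB)).
  assert (Hw := progr_pow_le a b z k hz).
  assert (Hk : (1 <= INR k)%R) by (change 1%R with (INR 1); apply le_INR; lia).
  assert (Hd : (INR (k / B) <= INR k / 2)%R).
  { assert (h : (2 * (k / B) <= k)%nat).
    { assert (h' := Nat.Div0.mul_div_le k B). nia. }
    apply le_INR in h. rewrite mult_INR in h. simpl INR in h. lra. }
  apply sqrt_le_1_alt in Hd.
  (* The factor 3/4 is a rational upper bound of sqrt(1/2), because 1/2 <= 9/16. *)
  assert (Hs2 : (sqrt (INR k / 2) <= 3/4 * sqrt (INR k))%R).
  { replace (3/4)%R with (sqrt (9/16)).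
    - rewrite <- sqrt_mult_alt by lra. apply sqrt_le_1_alt. lra.
    - replace (9/16)%R with ((3/4) * (3/4))%R by lra. apply sqrt_square. lra. }
  assert (H1 : (1 <= sqrt (INR k))%R).
  { rewrite <- sqrt_1. now apply sqrt_le_1_alt. }
  lra.
Qed.

(* [ring] and [field] do not see through the carrier of [R_AbelianMonoid]. *)
Ltac as_R_eq := lazymatch goal with |- @eq _ ?x ?y => change (@eq R x y) end.

(** * The weights [Qtilde] and their logarithmic form *)

(** The m-th terms of [Qtilde] and [Q] add up to 1/(B k (k+1)), which does not depend on m, and
    there are B - 1 of them. *)
Lemma Qtilde_Q (k B : nat) :
  (1 <= k)%nat -> (1 < B)%nat ->
  Qtilde k B
  = ((INR B - 1) / (INR B * INR k * (INR k + 1)) - Q k B)%R.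
Proof.
  intros hk hB. unfold Qtilde.
  assert (Hk : (0 < INR k)%R) by (apply lt_0_INR; lia).
  assert (HB : (0 < INR B)%R) by (apply lt_0_INR; lia).
  set (t := (1 / (INR B * INR k * (INR k + 1)))%R).
  assert (E : sum_n_m (fun _ => t) 1 (B - 1) = ((INR B - 1) * t)%R).
  { rewrite sum_n_m_const. replace (S (B - 1) - 1)%nat with (B - 1)%nat by lia.
    rewrite minus_INR by lia. reflexivity. }
  replace ((INR B - 1) / (INR B * INR k * (INR k + 1)))%R
    with ((INR B - 1) * t)%R by (unfold t; field; nra).
  rewrite <- E.
  apply Rplus_eq_reg_r with (Q k B). unfold Q, Rminus at 1.
  rewrite Rplus_assoc, Rplus_opp_l, Rplus_0_r.
  eapply eq_trans; [apply eq_sym, (sum_n_m_plus (G := R_AbelianMonoid))|].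
  apply sum_n_m_ext_loc. intros m hm.
  assert (Hm : (0 < INR m)%R) by (apply lt_0_INR; lia).
  rewrite minus_INR by lia. unfold t, plus; simpl.
  as_R_eq.
  field. nra.
Qed.

(** The g(j) of the outline; for j > 0 it is the integral of 1/x - 1/(j+1) over [j, j+1]. *)
Definition log_defect (j : nat) : R :=
  (ln (INR j + 1) - ln (INR j) - 1 / (INR j + 1))%R.

(** Both bounds are log(1 + t) <= t, taken at t = 1/j for the upper and at t = -1/(j+1) for the
    lower one. *)
Lemma log_defect_bounds (j : nat) :
  (0 < j)%nat -> (0 <= log_defect j <= 1 / INR j - 1 / (INR j + 1))%R.
Proof.
  intros hj. unfold log_defect.
  assert (Hj : (0 < INR j)%R) by (apply lt_0_INR; lia).
  assert (Hln : forall t, (-1 < t -> ln (1 + t) <= t)%R).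
  { intros t ht. rewrite <- (ln_exp t) at 2.
    apply Rcomplements.ln_le; [lra|]. apply exp_ineq1_le. }
  assert (H1 := Hln (1 / INR j)%R).
  assert (H2 := Hln (- (1 / (INR j + 1)))%R).
  assert (h1 : (0 < 1 / INR j)%R) by (apply Rdiv_lt_0_compat; lra).
  assert (h2 : (0 < 1 / (INR j + 1))%R) by (apply Rdiv_lt_0_compat; lra).
  assert (h3 : (1 / (INR j + 1) < 1)%R).
  { apply Rlt_div_l; lra. }
  replace (1 + 1 / INR j)%R with ((INR j + 1) / INR j)%R in H1 by (field; lra).
  replace (1 + - (1 / (INR j + 1)))%R with (INR j / (INR j + 1))%R in H2
    by (field; lra).
  rewrite ln_div in H1, H2 by lra. lra.
Qed.

(** The index is shifted to start at 0 so that the reciprocals cancel literally against those of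
    [sum_n_log_defect]; the shift costs one extra last term. *)
Lemma sum_n_inv_shift (x : R) (y : R) (r : nat) :
  sum_n_m (fun m => (1 / (x + INR m) - y)%R) 1 r
  = (sum_n (fun m => 1 / (x + INR m + 1))%R r
     - 1 / (x + INR r + 1) - INR r * y)%R.
Proof.
  induction r as [|r IH].
  - rewrite sum_n_m_zero, sum_O by lia. unfold zero; simpl. ring.
  - rewrite sum_n_Sm, sum_Sn, IH by lia. unfold plus; cbn -[INR].
    rewrite S_INR.
    replace (x + INR r + 1)%R with (x + (INR r + 1))%R by ring. ring.
Qed.

Lemma sum_n_log_defect (n r : nat) :
  sum_n (fun m => log_defect (n + m)) r
  = (ln (INR n + INR r + 1) - ln (INR n)
     - sum_n (fun m => 1 / (INR n + INR m + 1))%R r)%R.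
Proof.
  induction r as [|r IH].
  - rewrite !sum_O, Nat.add_0_r. unfold log_defect. simpl INR.
    now rewrite !Rplus_0_r.
  - rewrite !sum_Sn, IH. unfold plus, log_defect; cbn -[INR].
    rewrite plus_INR, S_INR.
    replace (INR n + (INR r + 1))%R with (INR n + INR r + 1)%R by ring. ring.
Qed.

(** Partial fractions give 1/(Bk+m) - 1/(Bk+B) for each term. The logarithms over a block telescope
    to log(B(k+1)) - log(Bk), where the factor B cancels, leaving the logarithm in
    [log_defect k]. *)
Lemma Qtilde_log_defect (k B : nat) :
  (0 < k)%nat -> (1 < B)%nat ->
  Qtilde k B
  = (log_defect k - sum_n (fun m => log_defect (B * k + m)) (B - 1))%R.
Proof.
  intros hk hB.
  assert (Hk : (0 < INR k)%R) by (apply lt_0_INR; lia).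
  assert (HB : (0 < INR B)%R) by (apply lt_0_INR; lia).
  unfold Qtilde.
  rewrite (sum_n_m_ext_loc _
    (fun m => (1 / (INR B * INR k + INR m) - 1 / (INR B * INR k + INR B))%R)).
  2:{ intros m hm. assert (Hm : (0 < INR m)%R) by (apply lt_0_INR; lia).
      rewrite minus_INR by lia. as_R_eq. field. nra. }
  rewrite sum_n_inv_shift, sum_n_log_defect, mult_INR, minus_INR by lia.
  simpl (INR 1). unfold log_defect.
  replace (INR B * INR k + (INR B - 1) + 1)%R with (INR B * (INR k + 1))%R by ring.
  replace (INR B * INR k + INR B)%R with (INR B * (INR k + 1))%R by ring.
  rewrite !ln_mult by lra. field. lra.
Qed.

(** * Summation of the weighted coefficients by blocks *)

Lemma sum_n_cut (f : nat -> C) (n r : nat) :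
  sum_n f (n + S r) = sum_n f n + sum_n (fun i => f (S n + i)%nat) r.
Proof.
  induction r as [|r IH].
  - rewrite sum_O, Nat.add_1_r, sum_Sn, Nat.add_0_r. reflexivity.
  - rewrite Nat.add_succ_r, sum_Sn, IH, (sum_Sn _ r).
    replace (S n + S r)%nat with (S (n + S r)) by lia.
    apply eq_sym, Cplus_assoc.
Qed.

(** Blocks have length [S B] because [sum_n] includes its upper index; the lemma is used with
    [B - 1] in place of [B]. *)
Lemma sum_n_blocks (B : nat) (f : nat -> C) (N : nat) :
  sum_n f (S B * N + B)
  = sum_n (fun k => sum_n (fun m => f (S B * k + m)%nat) B) N.
Proof.
  induction N as [|N IH].
  - rewrite sum_O, Nat.mul_0_r. reflexivity.
  - rewrite sum_Sn, <- IH.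
    replace (S B * S N + B)%nat with ((S B * N + B) + S B)%nat by lia.
    rewrite sum_n_cut. apply (f_equal (Cplus _)).
    apply sum_n_ext. intros m. f_equal. lia.
Qed.

Lemma Cmod_sum_telescope (f : nat -> C) (K : R) (n r : nat) :
  (forall i, (i <= r)%nat ->
    (Cmod (f i) <= K * (1 / (INR n + INR i) - 1 / (INR n + INR i + 1)))%R) ->
  (Cmod (sum_n f r) <= K * (1 / INR n - 1 / (INR n + INR r + 1)))%R.
Proof.
  induction r as [|r IH]; intros H.
  - rewrite sum_O. specialize (H O (Nat.le_refl _)). simpl INR in *.
    now rewrite Rplus_0_r in *.
  - rewrite sum_Sn. eapply Rle_trans; [apply Cmod_triangle|].
    specialize (IH (fun i hi => H i (Nat.le_le_succ_r _ _ hi))).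
    specialize (H (S r) (Nat.le_refl _)). rewrite S_INR in *.
    replace (INR n + (INR r + 1))%R with (INR n + INR r + 1)%R in * by ring. lra.
Qed.

Lemma sum_n_Cmult_RtoC (q : C) (f : nat -> R) (r : nat) :
  q * RtoC (sum_n f r) = sum_n (fun m => q * RtoC (f m)) r.
Proof.
  induction r as [|r IH].
  - now rewrite !sum_O.
  - rewrite !sum_Sn, <- IH. change (plus (sum_n f r) (f (S r))) with (sum_n f r + f (S r))%R.
    rewrite RtoC_plus. apply Cmult_plus_distr_l.
Qed.

(** This is the error bound of the block summation; it is dominated by 4 / sqrt(N+1). *)
Lemma lim_sqrt_div : is_lim_seq (fun N => 4 * (sqrt (INR N) / (INR N + 1)))%R 0.
Proof.
  apply is_lim_seq_le_le with (fun _ => 0%R) (fun N => 4 * / sqrt (INR N + 1))%R.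
  - intros N. assert (h := pos_INR N).
    assert (h1 : (0 < sqrt (INR N + 1))%R) by (apply sqrt_lt_R0; lra).
    assert (h2 : (sqrt (INR N) <= sqrt (INR N + 1))%R) by (apply sqrt_le_1_alt; lra).
    assert (h3 := sqrt_pos (INR N)).
    assert (h4 : (sqrt (INR N) / (INR N + 1) <= / sqrt (INR N + 1))%R).
    { rewrite <- (sqrt_sqrt (INR N + 1)) at 1 by lra.
      apply Rle_div_l; [nra|].
      replace (/ sqrt (INR N + 1) * (sqrt (INR N + 1) * sqrt (INR N + 1)))%R
        with (sqrt (INR N + 1)) by (field; lra). exact h2. }
    assert (h5 : (0 <= sqrt (INR N) / (INR N + 1))%R).
    { apply Rdiv_le_0_compat; lra. }
    lra.
  - apply is_lim_seq_const.
  - assert (H : is_lim_seq (fun N => / sqrt (INR N + 1))%R 0).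
    { replace (Finite 0) with (Rbar_inv p_infty) by reflexivity.
      apply is_lim_seq_inv; [|discriminate].
      apply (filterlim_comp _ _ _ (fun N => INR N + 1)%R sqrt _
        (Rbar_locally p_infty) _ ); [|exact filterlim_sqrt_p].
      apply (is_lim_seq_ext (fun n => INR (S n))).
      - intros n. apply S_INR.
      - apply (is_lim_seq_incr_1 INR), is_lim_seq_INR. }
    apply (is_lim_seq_scal_l _ 4) in H. simpl in H.
    now rewrite Rmult_0_r in H.
Qed.

(** Convergence of the weighted series is a conclusion: the termwise difference from the convergent
    series [v] has partial sums that are boundary terms tending to 0. *)
Lemma is_series_coeffs_Qtilde (a b B : nat) (z : C) (c : nat -> C) (l : C) :
  (0 < a)%nat -> (0 < b)%nat -> (1 < B)%nat -> (Cmod z <= 1)%R ->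
  is_gen_coeffs a b B z c ->
  is_series (fun n => z ^ n * RtoC (log_defect (a * n + b))) l ->
  is_series (fun k => c (S k) * RtoC (Qtilde (S k) B)) l.
Proof.
  intros ha hb hB hz hc Hl.
  assert (h0 : c O = 0) by (apply (gen_coeffs_0 a b B z c); assumption || lia).
  assert (hrec := fun k => gen_coeffs_rec a b B z c k ha ltac:(lia) hz hc).
  assert (hbd := fun k => gen_coeffs_le_sqrt a b B z c k ha hb hB hz hc).
  set (g := fun k => RtoC (log_defect k)).
  set (v := fun k => progr a b (fun n => z ^ n) k * g k).
  assert (Hv : is_series v l).
  { apply (is_series_progr a b _ _ ha) in Hl.
    eapply is_series_Cext; [|exact Hl]. intros n. symmetry.
    apply (progr_mult a b (fun n => z ^ n) g). }
  clear Hl.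
  set (cQ := fun k => c k * RtoC (Qtilde k B)).
  set (f := fun j => c (j / B)%nat * g j).
  (* By the recurrence [v k + f k] is c_k g(k), and subtracting c_k Qtilde(k) leaves c_k times the
     sum of g over the k-th block, on which [j / B] is constantly [k]. *)
  assert (Hterm : forall k,
    (v k - cQ k) + f k = sum_n (fun m => f (B * k + m)%nat) (B - 1)).
  { intros k.
    transitivity (c k * RtoC (sum_n (fun m => log_defect (B * k + m)) (B - 1))).
    (* The logarithmic form of [Qtilde] requires k > 0. At k = 0 both sides vanish because c_0 = w_0
       = 0, whatever the value of [log_defect 0]. *)
    - destruct (Nat.eq_dec k 0) as [->|hk].
      + unfold v, cQ, f. specialize (hrec O).
        rewrite Nat.Div0.div_0_l, h0 in *.
        transitivity ((progr a b (fun n => z ^ n) 0 + 0) * g 0%nat); [ring|].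
        rewrite <- hrec. ring.
      + unfold v, cQ, f. rewrite Qtilde_log_defect by lia.
        rewrite RtoC_minus. fold (g k). rewrite (hrec k) at 1 2.
        replace (c k) with (progr a b (fun n => z ^ n) k + c (k / B)%nat)
          by (symmetry; apply hrec).
        ring.
    - rewrite sum_n_Cmult_RtoC. apply sum_n_ext_loc. intros m hm.
      unfold f. replace ((B * k + m) / B)%nat with k
        by (apply Nat.div_unique with m; lia).
      reflexivity. }
  assert (Hdiff : is_series (fun k => v k - cQ k) (RtoC 0)).
  { apply is_series_C_bound with (2 := lim_sqrt_div). intros N.
    (* Chosen so that [N + S r] equals B N + B - 1, the last index of block N. *)
    set (r := ((B - 1) * N + B - 2)%nat).
    assert (E : sum_n (fun k => v k - cQ k) N - 0 = sum_n (fun i => f (S N + i)%nat) r).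
    { assert (E1 : sum_n f (N + S r)
        = sum_n (fun k => v k - cQ k) N + sum_n f N).
      { replace (N + S r)%nat with (S (B - 1) * N + (B - 1))%nat by (unfold r; nia).
        rewrite sum_n_blocks. symmetry.
        eapply eq_trans; [apply eq_sym, (sum_n_plus (G := C_AbelianMonoid))|].
        apply sum_n_ext. intros k.
        replace (S (B - 1))%nat with B by lia. apply Hterm. }
      rewrite sum_n_cut in E1.
      transitivity (sum_n (fun k => v k - cQ k) N + sum_n f N - sum_n f N); [ring|].
      rewrite <- E1. ring. }
    rewrite E.
    eapply Rle_trans;
      [apply (Cmod_sum_telescope _ (4 * sqrt (INR N)) (S N) r)|].
    - intros i hi. unfold f. rewrite Cmod_mult.
      apply Rmult_le_compat; try apply Cmod_ge_0.
      + eapply Rle_trans; [apply hbd|]. apply Rmult_le_compat_l; [lra|].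
        apply sqrt_le_1_alt, le_INR.
        (* All indices stay below B (N+1), so the coefficient index is at most N and one bound 4
           sqrt N serves the whole sum. *)
        assert ((S N + i) / B < S N)%nat; [|lia].
        apply Nat.Div0.div_lt_upper_bound. unfold r in hi. nia.
      + destruct (log_defect_bounds (S N + i) ltac:(lia)) as [h1 h2].
        unfold g. rewrite Cmod_R, Rabs_pos_eq, <- plus_INR by assumption.
        exact h2.
    - rewrite S_INR. assert (hN := pos_INR N). assert (hr := pos_INR r).
      assert (hs := sqrt_pos (INR N)).
      assert (0 < 1 / (INR N + 1 + INR r + 1))%R by (apply Rdiv_lt_0_compat; lra).
      unfold Rdiv at 3. unfold Rdiv in *. nra. }
  apply (is_series_C_tail cQ). unfold cQ at 2. rewrite h0, Cmult_0_l, Cplus_0_l.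
  assert (H := is_series_Cminus _ _ _ _ Hv Hdiff).
  replace (l - 0) with l in H by ring.
  eapply is_series_Cext; [|exact H]. intros n. cbv beta. ring.
Qed.

(** Since a n + b >= n + 1, the terms are dominated by the telescoping series of 1/(n+1) -
    1/(n+2). *)
Lemma ex_series_log_defect (a b : nat) (z : C) :
  (0 < a)%nat -> (0 < b)%nat -> (Cmod z <= 1)%R ->
  ex_series (fun n => z ^ n * RtoC (log_defect (a * n + b))).
Proof.
  intros ha hb hz.
  apply (ex_series_le (V := C_CompleteNormedModule) _
    (fun n => 1 / (INR n + 1) - 1 / (INR n + 2))%R).
  - intros n. change (norm ?x) with (Cmod x).
    rewrite Cmod_mult, Cmod_pow, Cmod_R.
    destruct (log_defect_bounds (a * n + b) ltac:(lia)) as [h1 h2].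
    rewrite Rabs_pos_eq by assumption.
    assert (h3 : (INR n + 1 <= INR (a * n + b))%R).
    { rewrite <- S_INR. apply le_INR. nia. }
    set (m := INR (a * n + b)) in *. assert (hn := pos_INR n).
    assert (hp : (Cmod z ^ n <= 1)%R).
    { rewrite <- (pow1 n). apply pow_incr. split; [apply Cmod_ge_0|exact hz]. }
    assert (hp0 : (0 <= Cmod z ^ n)%R) by apply pow_le, Cmod_ge_0.
    apply Rle_trans with (1 / m - 1 / (m + 1))%R; [nra|].
    replace (1 / m - 1 / (m + 1))%R with (/ (m * (m + 1)))%R by (field; lra).
    replace (1 / (INR n + 1) - 1 / (INR n + 2))%R
      with (/ ((INR n + 1) * (INR n + 2)))%R by (field; lra).
    apply Rinv_le_contravar; nra.
  - exists 1%R.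
    assert (Hs : forall N, sum_n (fun n => 1 / (INR n + 1) - 1 / (INR n + 2))%R N
      = (1 - / (INR N + 2))%R).
    { induction N as [|N IH].
      - rewrite sum_O. simpl INR. as_R_eq. field.
      - rewrite sum_Sn, IH. unfold plus; cbn -[INR]. rewrite S_INR.
        assert (hN := pos_INR N). field. lra. }
    change (is_lim_seq (sum_n (fun n => 1 / (INR n + 1) - 1 / (INR n + 2))%R) 1%R).
    apply is_lim_seq_ext with (fun N => 1 - / (INR N + 2))%R; [now intros; rewrite Hs|].
    replace (Finite 1) with (Finite (1 - 0)) by (f_equal; apply Rminus_0_r).
    apply is_lim_seq_minus'; [apply is_lim_seq_const|].
    apply (is_lim_seq_ext (fun N => / INR (N + 2))%R).
    { intros N. now rewrite plus_INR. }
    apply (is_lim_seq_incr_n (fun N => / INR N)%R 2).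
    replace (Finite 0) with (Rbar_inv p_infty) by reflexivity.
    apply is_lim_seq_inv; [apply is_lim_seq_INR|discriminate].
Qed.

(** * The integral and its expansion *)

(** The triangle inequality with |z x^a| <= x. The factor 1 - x of the numerator thus compensates
    the denominator uniformly in [z]. *)
Lemma denominator_ge (a : nat) (z : C) (x : R) :
  (0 < a)%nat -> (Cmod z <= 1)%R -> (0 <= x <= 1)%R ->
  (1 - x <= Cmod (1 - z * RtoC x ^ a))%R.
Proof.
  intros ha hz hx.
  assert (hm : (Cmod (z * RtoC x ^ a) <= x)%R).
  { rewrite Cmod_mult, Cmod_pow, Cmod_R, Rabs_pos_eq by lra.
    assert (h1 := Cmod_ge_0 z). destruct a as [|a]; [lia|]. simpl.
    assert (h2 : (x ^ a <= 1)%R) by (rewrite <- (pow1 a); apply pow_incr; lra).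
    assert (h3 : (0 <= x ^ a)%R) by (apply pow_le; lra).
    assert (h4 : (x * x ^ a <= x)%R) by nra.
    assert (h5 : (0 <= x * x ^ a)%R) by nra. nra. }
  assert (h := Cmod_triangle (1 - z * RtoC x ^ a) (z * RtoC x ^ a)).
  replace (1 - z * RtoC x ^ a + z * RtoC x ^ a) with (RtoC 1) in h by ring.
  rewrite Cmod_1 in h. lra.
Qed.

Lemma denominator_neq_0 (a : nat) (z : C) (x : R) :
  (0 < a)%nat -> (Cmod z <= 1)%R -> (0 <= x < 1)%R -> 1 - z * RtoC x ^ a <> 0.
Proof.
  intros ha hz hx E. assert (h := denominator_ge a z x ha hz ltac:(lra)).
  rewrite E, Cmod_0 in h. lra.
Qed.

(** Division is total, so the vanishing numerator decides the value even for z = 1. *)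
Lemma integrand_at_1 (a b : nat) (z : C) : integrand a b z 1 = 0.
Proof. unfold integrand, Cdiv. ring. Qed.

Lemma Cmod_integrand_le (a b : nat) (z : C) (x : R) :
  (0 < a)%nat -> (Cmod z <= 1)%R -> (0 <= x <= 1)%R ->
  (Cmod (integrand a b z x) <= 1)%R.
Proof.
  intros ha hz hx. destruct (Req_dec x 1) as [->|h1].
  { rewrite integrand_at_1, Cmod_0. lra. }
  unfold integrand.
  assert (hd := denominator_ge a z x ha hz hx).
  rewrite Cmod_div by (apply denominator_neq_0; trivial; lra).
  rewrite Cmod_mult, Cmod_pow, <- RtoC_minus, !Cmod_R, !Rabs_pos_eq by lra.
  assert (h2 : (x ^ (b - 1) <= 1)%R).
  { rewrite <- (pow1 (b - 1)). apply pow_incr. lra. }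
  assert (h3 : (0 <= x ^ (b - 1))%R) by (apply pow_le; lra).
  apply Rle_div_l; nra.
Qed.

(** Iterates h = x^(b-1) (1-x) + z x^a h for the integrand h. With the remainder written through h
    itself, the identity also holds at x = 1, and the bound |h| <= 1 controls it. *)
Lemma integrand_expand (a b : nat) (z : C) (x : R) (N : nat) :
  (0 < a)%nat -> (0 < b)%nat -> (Cmod z <= 1)%R -> (0 <= x <= 1)%R ->
  integrand a b z x
  = sum_n (fun n => RtoC (x ^ (a * n + b - 1) * (1 - x)) * z ^ n) N
    + z ^ S N * RtoC x ^ (a * S N) * integrand a b z x.
Proof.
  intros ha hb hz hx.
  assert (Hf : integrand a b z x
    = RtoC x ^ (b - 1) * (1 - RtoC x) + z * RtoC x ^ a * integrand a b z x).
  { destruct (Req_dec x 1) as [->|h1].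
    - rewrite integrand_at_1. ring.
    - unfold integrand. field. apply denominator_neq_0; trivial; lra. }
  assert (Hstep : forall n, z ^ n * RtoC x ^ (a * n) * integrand a b z x
    = RtoC (x ^ (a * n + b - 1) * (1 - x)) * z ^ n
      + z ^ S n * RtoC x ^ (a * S n) * integrand a b z x).
  { intros n. rewrite Hf at 1.
    rewrite RtoC_mult, RtoC_pow, RtoC_minus.
    replace (a * n + b - 1)%nat with (a * n + (b - 1))%nat by lia.
    replace (a * S n)%nat with (a * n + a)%nat by lia.
    rewrite !Cpow_add_r. simpl. ring. }
  induction N as [|N IH].
  - rewrite sum_O, <- Hstep, Nat.mul_0_r. simpl. ring.
  - rewrite IH at 1. rewrite Hstep, sum_Sn. apply Cplus_assoc.
Qed.

Lemma is_RInt_pow (n : nat) :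
  is_RInt (fun x => x ^ n)%R 0 1 (1 / (INR n + 1))%R.
Proof.
  assert (hn := pos_INR n).
  replace (1 / (INR n + 1))%R
    with (minus (1 ^ S n / (INR n + 1)) (0 ^ S n / (INR n + 1)))%R.
  - apply (is_RInt_derive (fun x => x ^ S n / (INR n + 1))%R).
    + intros x _. auto_derive; [trivial|].
      change (1 * (INR (S n) * x ^ n) * / (INR n + 1) = x ^ n)%R.
      rewrite S_INR. field. lra.
    + intros x _. apply (ex_derive_continuous (V := R_NormedModule)). auto_derive. trivial.
  - unfold minus, plus, opp. simpl. rewrite pow1, Rmult_0_l. as_R_eq.
    unfold Rdiv. ring.
Qed.

Lemma is_RInt_RtoC_mult (p : R -> R) (q : C) (x y l : R) :
  is_RInt p x y l ->
  is_RInt (V := C_R_NormedModule) (fun t => RtoC (p t) * q) x y (RtoC l * q).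
Proof.
  intros H.
  replace (RtoC l * q) with ((l * Re q)%R, (l * Im q)%R)
    by (destruct q; unfold RtoC, Cmult; simpl; f_equal; ring).
  apply (is_RInt_fct_extend_pair (U := R_NormedModule) (V := R_NormedModule)).
  - apply (is_RInt_ext (fun t => scal (Re q) (p t))).
    + intros t _. unfold scal; simpl. unfold mult; simpl. as_R_eq. unfold Re. ring.
    + replace (l * Re q)%R with (scal (Re q) l) by apply Rmult_comm.
      now apply (is_RInt_scal (V := R_NormedModule)).
  - apply (is_RInt_ext (fun t => scal (Im q) (p t))).
    + intros t _. unfold scal; simpl. unfold mult; simpl. as_R_eq. unfold Im. ring.
    + replace (l * Im q)%R with (scal (Im q) l) by apply Rmult_comm.
      now apply (is_RInt_scal (V := R_NormedModule)).
Qed.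

Lemma is_RInt_integrand_term (a b : nat) (z : C) (n : nat) :
  (0 < b)%nat ->
  is_RInt (V := C_R_NormedModule)
    (fun x => RtoC (x ^ (a * n + b - 1) * (1 - x)) * z ^ n) 0 1
    (RtoC (1 / INR (a * n + b) - 1 / (INR (a * n + b) + 1)) * z ^ n).
Proof.
  intros hb. apply is_RInt_RtoC_mult.
  assert (H1 := is_RInt_pow (a * n + b - 1)).
  assert (H2 := is_RInt_pow (a * n + b)).
  replace (INR (a * n + b - 1) + 1)%R with (INR (a * n + b)) in H1.
  2:{ rewrite <- S_INR. f_equal. lia. }
  eapply is_RInt_ext;
    [|exact (is_RInt_minus (V := R_NormedModule) _ _ _ _ _ _ H1 H2)].
  intros x _. unfold minus, plus, opp; simpl. as_R_eq.
  replace (a * n + b)%nat with (S (a * n + b - 1)) at 2 by lia. simpl. ring.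
Qed.

(** The factor is 1 + x + ... + x^a, whose constant term gives the lower bound 1. *)
Lemma one_minus_pow_factor (a : nat) :
  exists q : R -> R,
    (forall x, continuous q x) /\
    (forall x, (1 - x ^ S a = (1 - x) * q x)%R) /\
    (forall x, (0 <= x)%R -> (1 <= q x)%R).
Proof.
  induction a as [|a [q [Hc [He Hp]]]].
  - exists (fun _ => 1%R). split; [|split].
    + intros x. apply continuous_const.
    + intros x. simpl. ring.
    + intros; lra.
  - exists (fun x => q x + x ^ S a)%R. split; [|split].
    + intros x. apply (continuous_plus (V := R_NormedModule)); [apply Hc|].
      apply (ex_derive_continuous (V := R_NormedModule)). auto_derive. trivial.
    + intros x. rewrite Rmult_plus_distr_l, <- He. simpl. ring.
    + intros x hx. specialize (Hp x hx). assert (h := pow_le x (S a) hx). lra.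
Qed.

(* For [z <> 1] the denominator has no zero on [0, 1]; for [z = 1] the factor
   [1 - x] cancels. *)
Lemma ex_RInt_integrand (a b : nat) (z : C) :
  (0 < a)%nat -> (Cmod z <= 1)%R ->
  ex_RInt (V := C_R_NormedModule) (integrand a b z) 0 1.
Proof.
  intros ha hz.
  destruct (Ceq_dec z 1) as [->|hz1].
  - destruct a as [|a]; [lia|].
    destruct (one_minus_pow_factor a) as [q [Hc [He Hp]]].
    assert (H : ex_RInt (fun x => x ^ (b - 1) * / q x)%R 0 1).
    { apply (ex_RInt_continuous (V := R_CompleteNormedModule)). intros x hx.
      rewrite Rmin_left, Rmax_right in hx by lra.
      apply (continuous_mult (K := R_AbsRing)).
      - apply (ex_derive_continuous (V := R_NormedModule)). auto_derive. trivial.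
      - apply continuous_Rinv_comp; [apply Hc|].
        specialize (Hp x ltac:(lra)). lra. }
    destruct H as [l H]. exists (RtoC l * 1).
    apply (is_RInt_RtoC_mult _ 1) in H.
    eapply is_RInt_ext; [|exact H]. intros x hx.
    rewrite Rmin_left, Rmax_right in hx by lra.
    assert (Hq := Hp x ltac:(lra)).
    unfold integrand. rewrite Cmult_1_l, <- !RtoC_pow, <- !RtoC_minus, He.
    rewrite Cmult_1_r, <- RtoC_mult, <- RtoC_div by nra.
    f_equal. field. lra.
  (* [D] is the squared modulus of the denominator; dividing by it makes both coordinates of the
     integrand real rational functions. *)
  - set (D := fun x => ((1 - Re z * x ^ a) ^ 2 + (Im z * x ^ a) ^ 2)%R).
    assert (HD : forall x : R, 1 - z * RtoC x ^ a
      = ((1 - Re z * x ^ a)%R, (- (Im z * x ^ a))%R)).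
    { intros x. rewrite <- RtoC_pow. destruct z as [u v].
      unfold RtoC, Cminus, Cmult, Cplus, Copp; simpl. f_equal; ring. }
    assert (Hne : forall x, (0 <= x <= 1)%R -> D x <> 0%R).
    { intros x hx E. unfold D in E. rewrite <- !Rsqr_pow2 in E.
      apply Rplus_sqr_eq_0 in E as [E1 E2].
      assert (E' : 1 - z * RtoC x ^ a = 0).
      { rewrite HD, E1, E2, Ropp_0. reflexivity. }
      (* A zero at x = 1 would force z = 1; elsewhere the lower bound 1 - x on the modulus excludes
         it. *)
      destruct (Req_dec x 1) as [->|h1].
      - apply hz1. rewrite Cpow_1_l in E'.
        replace z with (1 - (1 - z * 1)) by ring. rewrite E'. ring.
      - revert E'. apply denominator_neq_0; trivial; lra. }
    apply (ex_RInt_ext (V := C_R_NormedModule) (fun x =>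
      ((x ^ (b - 1) * (1 - x) * ((1 - Re z * x ^ a) / D x))%R,
       (x ^ (b - 1) * (1 - x) * (Im z * x ^ a / D x))%R))).
    { intros x hx. rewrite Rmin_left, Rmax_right in hx by lra.
      unfold integrand. rewrite HD, <- RtoC_pow, <- RtoC_minus, <- RtoC_mult.
      specialize (Hne x ltac:(lra)). unfold D in *.
      unfold RtoC, Cdiv, Cinv, Cmult; simpl. f_equal; field; simpl in Hne; intros E;
        apply Hne; rewrite <- E; ring. }
    apply (ex_RInt_fct_extend_pair (U := R_NormedModule) (V := R_NormedModule));
      apply (ex_RInt_continuous (V := R_CompleteNormedModule)); intros x hx;
      rewrite Rmin_left, Rmax_right in hx by lra;
      specialize (Hne x hx); apply (ex_derive_continuous (V := R_NormedModule));
      unfold D in *; simpl fst; simpl snd; auto_derive; simpl in *; intuition.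
Qed.

(** Termwise integration with an explicit remainder: after N + 1 terms the error is at most the
    integral of x^(a(N+1)), that is 1/(a(N+1)+1). *)
Lemma is_series_integrand (a b : nat) (z : C) :
  (0 < a)%nat -> (0 < b)%nat -> (Cmod z <= 1)%R ->
  is_series
    (fun n => RtoC (1 / INR (a * n + b) - 1 / (INR (a * n + b) + 1)) * z ^ n)
    (RInt (V := C_R_CompleteNormedModule) (integrand a b z) 0 1).
Proof.
  intros ha hb hz.
  assert (HI := RInt_correct (V := C_R_CompleteNormedModule) _ _ _
    (ex_RInt_integrand a b z ha hz)).
  set (I := RInt _ 0 1) in *.
  set (T := fun n => RtoC (1 / INR (a * n + b) - 1 / (INR (a * n + b) + 1)) * z ^ n).
  apply is_series_C_bound with (fun N => / INR (S N))%R.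
  - intros N.
    assert (HS : is_RInt (V := C_R_NormedModule)
      (fun x => sum_n (fun n => RtoC (x ^ (a * n + b - 1) * (1 - x)) * z ^ n) N)
      0 1 (sum_n T N)).
    { induction N as [|N IH].
      - rewrite sum_O. eapply is_RInt_ext; [|exact (is_RInt_integrand_term a b z 0 hb)].
        intros x _. now rewrite sum_O.
      - rewrite sum_Sn. eapply is_RInt_ext;
          [|exact (is_RInt_plus (V := C_R_NormedModule) _ _ _ _ _ _ IH
                     (is_RInt_integrand_term a b z (S N) hb))].
        intros x _. now rewrite sum_Sn. }
    assert (HSI := is_RInt_minus (V := C_R_NormedModule) _ _ _ _ _ _ HS HI).
    change (minus (sum_n T N) I) with (sum_n T N - I) in HSI.
    rewrite Cmod_norm.
    apply Rle_trans with (1 / (INR (a * S N) + 1))%R.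
    + eapply norm_RInt_le; [| |exact HSI|exact (is_RInt_pow (a * S N))]; [lra|].
      intros x hx. cbv beta.
      match goal with |- (norm ?y <= _)%R => rewrite <- (Cmod_norm y) end.
      match goal with |- (Cmod (minus ?s ?y) <= _)%R =>
        change (Cmod (s - y) <= x ^ (a * S N))%R end.
      rewrite (integrand_expand a b z x N ha hb hz hx).
      match goal with |- (Cmod (?s - (?s + ?r)) <= _)%R =>
        replace (s - (s + r)) with (- r) by ring end.
      rewrite Cmod_opp, !Cmod_mult, !Cmod_pow, Cmod_R, Rabs_pos_eq by lra.
      assert (h1 := Cmod_integrand_le a b z x ha hz hx).
      assert (h2 : (Cmod z ^ S N <= 1)%R).
      { rewrite <- (pow1 (S N)). apply pow_incr. split; [apply Cmod_ge_0|exact hz]. }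
      assert (h3 : (0 <= Cmod z ^ S N)%R) by apply pow_le, Cmod_ge_0.
      assert (h4 : (0 <= x ^ (a * S N))%R) by (apply pow_le; lra).
      assert (h5 := Cmod_ge_0 (integrand a b z x)).
      assert (h6 : (Cmod z ^ S N * x ^ (a * S N) <= x ^ (a * S N))%R) by nra.
      nra.
    + assert (h : (INR (S N) <= INR (a * S N))%R) by (apply le_INR; nia).
      assert (h' : (0 < INR (S N))%R) by (apply lt_0_INR; lia).
      unfold Rdiv. rewrite Rmult_1_l. apply Rinv_le_contravar; lra.
  - apply (is_lim_seq_incr_1 (fun N => / INR N)%R).
    replace (Finite 0) with (Rbar_inv p_infty) by reflexivity.
    apply is_lim_seq_inv; [apply is_lim_seq_INR|discriminate].
Qed.

(** * Assembling the formula for [gamma] *)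

Theorem theorem4 (a b B : nat) (z : C) (c : nat -> C)
  (ha : (0 < a)%nat) (hb : (0 < b)%nat) (hB : (1 < B)%nat)
  (hz : (Cmod z <= 1)%R)
  (hc : is_gen_coeffs a b B z c) :
  (ex_series (gamma_term a b z) /\
   ex_RInt (V := C_R_NormedModule) (integrand a b z) 0 1 /\
   ex_series (fun k => c (S k) * RtoC (Qtilde (S k) B)) /\
   gamma a b z =
     RInt (V := C_R_CompleteNormedModule) (integrand a b z) 0 1
     - CSeries (fun k => c (S k) * RtoC (Qtilde (S k) B))) /\
  (forall k : nat, (1 <= k)%nat ->
     Qtilde k B
     = ((INR B - 1) / (INR B * INR k * (INR k + 1)) - Q k B)%R).
Proof.
  destruct (ex_series_log_defect a b z ha hb hz) as [l Hl].
  assert (HI := is_series_integrand a b z ha hb hz).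
  assert (HQ := is_series_coeffs_Qtilde a b B z c l ha hb hB hz hc Hl).
  assert (HG : is_series (gamma_term a b z)
    (RInt (V := C_R_CompleteNormedModule) (integrand a b z) 0 1 - l)).
  (* With m = a n + b, 1/m - log((m+1)/m) equals (1/m - 1/(m+1)) - g(m), so subtracting the two
     series gives [gamma_term]. *)
  { eapply is_series_Cext; [|exact (is_series_Cminus _ _ _ _ HI Hl)].
    intros n. unfold gamma_term, log_defect.
    assert (hm : (0 < INR (a * n + b))%R) by (apply lt_0_INR; lia).
    rewrite (plus_INR (a * n + b) 1), ln_div by (simpl; lra). simpl (INR 1).
    rewrite !RtoC_minus. ring. }
  split; [|intros k hk; now apply Qtilde_Q].
  repeat split.
  - now eexists; exact HG.
  - now apply ex_RInt_integrand.
  - now exists l.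
  - unfold gamma. now rewrite (CSeries_unique _ _ HG), (CSeries_unique _ _ HQ).
Qed.
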